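(* For every $r\in[0,2]$ there exists a Banach space $X$ such that $\mathcal T^s(X)=\mathcal T(X)=\mathcal T^{cc}(X)=r$.
   Context: All Banach spaces are nontrivial and real. $B_X$ and $S_X$ denote the closed unit ball and the unit sphere of $X$, $X^*$ is the dual, and $B(x,r)$ is the ball with center $x$ and radius $r$. A slice of $B_X$ is a set $S(B_X,x^*,\alpha)=\{x\in B_X: x^*(x)>1-\alpha\}$ with $x^*\in S_{X^*}$ and $\alpha>0$. A convex combination of subsets $W_1,\dots,W_n$ of $B_X$ is a set $\sum_{i=1}^n\lambda_iW_i=\{\sum_i\lambda_iw_i: w_i\in W_i\}$ with $n\in\mathbb N$, $\lambda_i\in[0,1]$, $\sum_{i=1}^n\lambda_i=1$. The Daugavet indices of thickness are: - $\mathcal T^s(X)=\inf\{r>0:$ there exist $x\in S_X$ and a slice $S$ of $B_X$ such that $S\subset B(x,r)\}$; - $\mathcal T(X)=\inf\{r>0:$ there exist $x\in S_X$ and a relatively weakly open subset $W$ of $B_X$ such that $\emptyset\ne W\subset B(x,r)\}$; - $\mathcal T^{cc}(X)=\inf\{r>0:$ there exist $x\in S_X$ and a convex combination $C$ of relatively weakly open subsets of $B_X$ such that $\emptyset\ne C\subset B(x,r)\}$. *)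

(* Defs.v *)
From mathcomp Require Import all_boot all_order all_algebra.
From mathcomp Require Import all_classical all_reals all_analysis.

Set Implicit Arguments.
Unset Strict Implicit.
Unset Printing Implicit Defensive.

Import Order.TTheory GRing.Theory Num.Theory.
Import numFieldNormedType.Exports.

Local Open Scope classical_set_scope.
Local Open Scope ring_scope.

Section thickness.
Context {R : realType}.
Variable X : normedModType R.

Definition unit_ball : set X := closed_ball 0 1.

Definition unit_sphere : set X := [set x | `|x| = 1].

Record dual := Dual {
  dual_fun :> {linear X -> R^o};
  dual_continuous : continuous dual_fun }.

(* The supremum is over a nonempty set, bounded because f is continuous. *)
Definition dual_norm (f : dual) : R := sup [set `|f x| | x in unit_ball].

(* The weak topology sigma(X, dual X): the coarsest one making every element of
   the dual continuous. *)
Definition weak_space : topologicalType :=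
  sup_topology (fun f : dual => Topological.class (initial_topology f)).

Definition slice (f : dual) (a : R) : set X :=
  unit_ball `&` [set x | 1 - a < f x].

Definition is_slice (S : set X) : Prop :=
  exists (f : dual) (a : R), [/\ dual_norm f = 1, 0 < a & S = slice f a].

Definition rel_weakly_open (W : set X) : Prop :=
  exists2 U : set weak_space, open U & W = U `&` unit_ball.

Definition convex_comb (n : nat) (l : 'I_n -> R) (W : 'I_n -> set X) : set X :=
  [set x | exists2 w : 'I_n -> X,
    (forall i, W i (w i)) & x = \sum_(i < n) l i *: w i].

Definition is_convex_comb_rel_weakly_open (C : set X) : Prop :=
  exists (n : nat) (l : 'I_n -> R) (W : 'I_n -> set X),
    [/\ forall i, 0 <= l i <= 1,
        \sum_(i < n) l i = 1,
        forall i, rel_weakly_open (W i) &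
        C = convex_comb l W].

(* The infimum is taken in the extended reals to avoid the default value of
   the real infimum on the empty set. *)
Definition thickness_index (P : set X -> Prop) : \bar R :=
  ereal_inf [set r%:E | r in [set r : R | 0 < r /\
    exists (x : X) (A : set X),
      [/\ unit_sphere x, P A & A `<=` closed_ball x r]]].

Definition thickness_s : \bar R := thickness_index is_slice.

Definition thickness : \bar R :=
  thickness_index (fun W => W !=set0 /\ rel_weakly_open W).

Definition thickness_cc : \bar R :=
  thickness_index (fun C => C !=set0 /\ is_convex_comb_rel_weakly_open C).

End thickness.

(* Main.v *)
Require Import Defs.
From HB Require Import structures.
From mathcomp Require Import all_boot all_order all_algebra.
From mathcomp Require Import all_classical all_reals all_analysis.
From mathcomp Require Import lra zify.

(* The space is the set of pairs (t, F) with t real and F a continuous function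
   on the Cantor space such that F(0) = m t, normed by
   sup_s max(|t|, |F(s)| + h|t|), where m = max(r - 1, 0), h = max(1 - r, 0).

   Upper bound: a slice {t > 1 - a} lies in the ball of radius r + 2a around
   (1, m), because m - h = r - 1 and |F(s)| <= 1 - h(1 - a) on that slice.

   Lower bound: let (t0, F0) have norm 1. Either h = 0 and |F0| exceeds m - e
   somewhere, or m = 0 and this is trivial. On pairwise disjoint clopen sets
   accumulating at such a point, any (t, F) of the unit ball can be given the
   value -(1 - h) sgn(F0) without leaving the ball. These modifications are
   disjoint bumps, hence weakly null, so they eventually stay in any given
   relatively weakly open set. Doing this with the same clopen set in all the
   members of a convex combination yields a point at distance at least
   m - e + 1 - h = r - e from (t0, F0). *)

Import Order.TTheory GRing.Theory Num.Theory.
Import numFieldNormedType.Exports.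

Local Open Scope classical_set_scope.
Local Open Scope ring_scope.

(** * Weakly null sequences, slices, and comparison of the three indices *)

Section weak_topology.
Context {R : realType} {X : normedModType R}.

Lemma unit_ballP (x : X) : unit_ball x <-> `|x| <= 1.
Proof. by rewrite /unit_ball closed_ballE// /closed_ball_/= sub0r normrN. Qed.

(** The bound on signed sums makes the values [|f (h n)|] summable, so they tend to 0. *)
Lemma weakly_null (h : nat -> X) (M : R) (f : dual X) :
  (forall N (s : nat -> R), (forall n, `|s n| <= 1) ->
    `|\sum_(n < N) s n *: h n| <= M) ->
  f (h n) @[n --> \oo] --> (0 : R).
Proof.
move=> hM.
have /linear_boundedP : bounded_near f (nbhs (0 : X)).
  exact/linear_bounded_continuous/dual_continuous.
move=> /pinfty_ex_gt0[C C0 fC].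
suff /cvg_series_cvg_0/norm_cvg0 : cvgn (series (fun n => `|f (h n)|)) by [].
apply: nondecreasing_is_cvgn.
  by apply/nondecreasing_seqP => n; rewrite /series/= big_nat_recr//= lerDl.
(* With s the signs of f (h n), the signed sums bound \sum_n |f (h n)|. *)
exists (C * M) => _ [N _ <-]; rewrite /series/= big_mkord.
have -> : \sum_(n < N) `|f (h n)| = f (\sum_(n < N) Num.sg (f (h n)) *: h n).
  rewrite linear_sum; apply: eq_bigr => n _.
  by rewrite linearZ/= normrEsg.
apply: le_trans (ler_norm _) _; apply: le_trans (fC _) _.
rewrite ler_wpM2l ?(ltW C0)//; apply: (hM N (fun n => Num.sg (f (h n)))) => n.
by rewrite normr_sg; case: eqP => //= _; rewrite ler01.
Qed.

Lemma weak_space_cvg (x : X) (h : nat -> X) :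
  (forall f : dual X, f (h n) @[n --> \oo] --> (0 : R)) ->
  x + h n @[n --> \oo] --> (x : weak_space X).
Proof.
move=> h0; apply/cvg_sup => f B.
rewrite nbhsE => -[U [[V oV <-] Vx] UB].
have : f (x + h n) @[n --> \oo] --> f x.
  rewrite (_ : (fun n => f (x + h n)) = (fun n => f x + f (h n))); last first.
    by apply/funext => n; rewrite linearD.
  rewrite -[X in _ --> X]addr0; apply: cvgD; [exact: cvg_cst|exact: h0].
move=> /(_ V) fV; have {fV} : \forall n \near \oo, V (f (x + h n)).
  by apply: fV; exact: open_nbhs_nbhs.
by apply: filterS => n Vn; apply: UB.
Qed.

Lemma rel_weakly_open_near {W : set X} (x : X) (h : nat -> X) :
  rel_weakly_open W -> W x ->
  (forall f : dual X, f (h n) @[n --> \oo] --> (0 : R)) ->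
  (forall n, `|x + h n| <= 1) ->
  \forall n \near \oo, W (x + h n).
Proof.
move=> [U oU ->] [Ux _] h0 h1.
have Ux' : nbhs (x : weak_space X) U by exact: open_nbhs_nbhs.
have : \forall n \near \oo, U (x + h n) := weak_space_cvg x h h0 U Ux'.
apply: filterS => n Un; split=> //.
exact/unit_ballP.
Qed.

Lemma slice_rel_weakly_open (f : dual X) (a : R) : rel_weakly_open (slice f a).
Proof.
exists [set x | 1 - a < f x]; last by rewrite /slice setIC.
rewrite openE => x /= fx.
suff : nbhs (x : initial_topology f) [set x | 1 - a < f x].
  (* Applied to the weak neighbourhood filter of [x] itself, [cvg_sup] says that each initial
     topology is coarser than the weak one. *)
  have [+ _] := cvg_sup (fun g : dual X =>
    Topological.class (initial_topology g)) (F := nbhs (x : weak_space X)) x _.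
  by move=> /(_ (fun _ => id) f); apply.
apply: open_nbhs_nbhs; split=> //.
by exists [set y : R^o | 1 - a < y]; [exact: open_gt|].
Qed.

Lemma slice_nonempty (f : dual X) (a : R) :
  dual_norm f = 1 -> 0 < a -> slice f a !=set0.
Proof.
move=> f1 a0.
have : 1 - a < dual_norm f by rewrite f1; lra.
move=> /sup_gt[|_ [x xB <-] fx].
  by exists `|f 0|; exists 0 => //; apply: closed_ballxx.
(* [dual_norm] is a supremum of absolute values, so the point found may have to be replaced by its
   opposite. *)
have [fx0|fx0] := leP 0 (f x).
  by exists x; split => //=; rewrite -(ger0_norm fx0).
exists (- x); split => /=; last by rewrite linearN -(ltr0_norm fx0).
by apply/unit_ballP; rewrite normrN; exact/unit_ballP.
Qed.

Lemma rel_weakly_open_convex_comb (W : set X) :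
  rel_weakly_open W -> is_convex_comb_rel_weakly_open W.
Proof.
move=> oW; exists 1%N, (fun=> 1), (fun=> W); split => //.
- by move=> _; rewrite ler01 lexx.
- by rewrite big_ord1.
- apply/seteqP; split => x.
    by move=> Wx; exists (fun=> x) => //; rewrite big_ord1 scale1r.
  by move=> [w Ww ->]; rewrite big_ord1 scale1r.
Qed.

Lemma le_thickness_index (P Q : set X -> Prop) : (forall A, P A -> Q A) ->
  (thickness_index Q <= thickness_index P)%E.
Proof.
move=> PQ; apply: ereal_inf_le_tmp; apply: image_subset => r [r0].
move=> [x [A [x1 PA Ar]]]; split => //.
by exists x, A; split => //; exact: PQ.
Qed.

Lemma thickness_le_thickness_s : (thickness X <= thickness_s X)%E.
Proof.
apply: le_thickness_index => _ [f [a [f1 a0 ->]]].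
by split; [exact: slice_nonempty|exact: slice_rel_weakly_open].
Qed.

Lemma thickness_cc_le_thickness : (thickness_cc X <= thickness X)%E.
Proof.
apply: le_thickness_index => W [W0 oW].
by split => //; exact: rel_weakly_open_convex_comb.
Qed.

End weak_topology.

(** * The Cantor space and the Banach space built on it *)

Definition cantor := nat -> bool.

(** The sets [agree k u] are the basic clopen neighbourhoods of [u]; the topology of the Cantor
    space enters only through them. *)
Definition agree (k : nat) (u v : cantor) := forall i, (i < k)%N -> u i = v i.

Definition cantor0 : cantor := fun=> false.

Section thick_space.
Context {R : realType}.
Variable r : R.

(* The constants m and h of the header. *)
Definition anchor : R := Num.max (r - 1) 0.
Definition slant : R := Num.max (1 - r) 0.

Lemma slant_ge0 : 0 <= slant. Proof. by rewrite le_max lexx orbT. Qed.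
Lemma anchor_ge0 : 0 <= anchor. Proof. by rewrite le_max lexx orbT. Qed.
Lemma anchorB : anchor - slant = r - 1.
Proof. by rewrite /anchor /slant; do 2 case: leP => ?; lra. Qed.

(* A function on [option cantor] stands for the pair of its value t at [None]
   and its restriction F to the Cantor space. *)
Record in_thick (f : option cantor -> R^o) : Prop := InThick {
  in_thick_bounded : exists M : R, forall o, `|f o| <= M;
  in_thick_continuous : forall u (e : R), 0 < e ->
    exists k, forall v, agree k u v -> `|f (Some u) - f (Some v)| <= e;
  in_thick_anchor : f (Some cantor0) = anchor * f None }.

Definition thick_pred : {pred option cantor -> R^o} := mem [set f | in_thick f].

Lemma thick_submod_closed : submod_closed thick_pred.
Proof.
split=> [|a f g]; rewrite !inE/=.
  split=> [|u e e0|]; last by rewrite /= mulr0.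
  - by exists 0 => o; rewrite normr0.
  - by exists 0%N => v _; rewrite subrr normr0 ltW.
move=> [[Mf fM] cf af] [[Mg gM] cg ag]; split=> [|u e e0|].
- exists (`|a| * Mf + Mg) => o.
  by rewrite (le_trans (ler_normD _ _))// lerD// normrM ler_wpM2l.
(* The denominator [1 + |a|] also covers [a = 0]. *)
- have e1 : 0 < e / 2 / (1 + `|a|) by rewrite !divr_gt0// ltr_wpDr.
  have e2 : 0 < e / 2 by rewrite divr_gt0.
  have [kf fk] := cf u _ e1; have [kg gk] := cg u _ e2.
  exists (maxn kf kg) => v uv.
  rewrite [X in `|X|](_ : _ = a * (f (Some u) - f (Some v)) +
    (g (Some u) - g (Some v))); last first.
    by rewrite mulrBr addrACA -opprD.
  rewrite (le_trans (ler_normD _ _))// [leRHS](splitr e) lerD//.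
    rewrite normrM (le_trans (ler_wpM2l _ (fk v _)))//.
      by move=> i ik; apply: uv; rewrite leq_max ik.
    by rewrite mulrCA ler_piMr ?(ltW e2)// ler_pdivrMr ?mul1r ?lerDr ?ltr_wpDr.
  by apply: gk => i ik; apply: uv; rewrite leq_max ik orbT.
- change (a * f (Some cantor0) + g (Some cantor0) =
    anchor * (a * f None + g None)).
  by rewrite af ag mulrDr mulrCA.
Qed.

HB.instance Definition _ := GRing.isSubmodClosed.Build R _ thick_pred
  thick_submod_closed.

Record thick := Thick {
  thick_fun :> option cantor -> R^o ;
  thickP : thick_fun \in thick_pred }.

HB.instance Definition _ := [isSub for thick_fun].
HB.instance Definition _ := [Choice of thick by <:].
HB.instance Definition _ := [SubChoice_isSubLmodule of thick by <:].

Lemma thick_in (x : thick) : in_thick x.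
Proof. by case: x => f /=; rewrite inE. Qed.

Lemma thickD (x y : thick) o : (x + y) o = x o + y o.
Proof. by rewrite -[thick_fun _]/(val _) raddfD. Qed.

Lemma thickB (x y : thick) o : (x - y) o = x o - y o.
Proof. by rewrite -[thick_fun _]/(val _) raddfB. Qed.

Lemma thickZ (a : R) (x : thick) o : (a *: x) o = a * x o.
Proof. by []. Qed.

Lemma thick_sum n (F : 'I_n -> thick) o :
  (\sum_(i < n) F i) o = \sum_(i < n) F i o.
Proof. by rewrite -[thick_fun _]/(val _) raddf_sum fct_sumE. Qed.

Lemma thick_eq (x y : thick) : (forall o, x o = y o) -> x = y.
Proof. by move=> xy; apply/val_inj/funext. Qed.

Definition thick_val (x : thick) (s : cantor) : R :=
  Num.max `|x None| (`|x (Some s)| + slant * `|x None|).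

Definition thick_norm (x : thick) : R := sup (range (thick_val x)).

Lemma thick_val_le (x : thick) s M :
  (thick_val x s <= M) =
  (`|x None| <= M) && (`|x (Some s)| + slant * `|x None| <= M).
Proof. by rewrite ge_max. Qed.

Lemma thick_val_ubound (x : thick) : has_ubound (range (thick_val x)).
Proof.
have [[M xM] _ _] := thick_in x.
exists (M + slant * M) => _ [s _ <-]; rewrite thick_val_le.
have M0 : 0 <= M by apply: le_trans (xM None).
rewrite lerD// ?ler_wpM2l ?slant_ge0// andbT.
by rewrite (le_trans (xM _))// lerDl mulr_ge0// slant_ge0.
Qed.

Lemma thick_norm_leP (x : thick) M :
  thick_norm x <= M <-> forall s, thick_val x s <= M.
Proof.
split=> [xM s|xM].
  apply: le_trans xM; apply: ub_le_sup; first exact: thick_val_ubound.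
  by exists s.
apply: ge_sup; first by exists (thick_val x cantor0); exists cantor0.
by move=> _ [s _ <-].
Qed.

Lemma le_thick_val (x : thick) s : thick_val x s <= thick_norm x.
Proof. by move: s; apply/thick_norm_leP. Qed.

Lemma le_thick_norm (x : thick) o : `|x o| <= thick_norm x.
Proof.
case: o => [s|]; last first.
  by have := le_thick_val x cantor0; rewrite thick_val_le => /andP[].
have := le_thick_val x s; rewrite thick_val_le => /andP[_].
by apply: le_trans; rewrite lerDl mulr_ge0// slant_ge0.
Qed.

Lemma thick_normD (x y : thick) :
  thick_norm (x + y) <= thick_norm x + thick_norm y.
Proof.
apply/thick_norm_leP => s; rewrite thick_val_le !thickD.
have := le_thick_val x s; rewrite thick_val_le => /andP[xN xs].
have := le_thick_val y s; rewrite thick_val_le => /andP[yN ys].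
rewrite (le_trans (ler_normD _ _) (lerD xN yN))/=.
apply: le_trans (lerD xs ys).
rewrite addrACA -mulrDr lerD ?ler_normD// ler_wpM2l ?slant_ge0//.
exact: ler_normD.
Qed.

Lemma thick_normZ_le (a : R) (x : thick) :
  thick_norm (a *: x) <= `|a| * thick_norm x.
Proof.
apply/thick_norm_leP => s; rewrite thick_val_le !thickZ !normrM.
have := le_thick_val x s; rewrite thick_val_le => /andP[xN xs].
by rewrite ler_wpM2l//= mulrCA -mulrDr ler_wpM2l.
Qed.

Lemma thick_normZ (a : R) (x : thick) :
  thick_norm (a *: x) = `|a| * thick_norm x.
Proof.
apply/eqP; rewrite eq_le thick_normZ_le/=.
have [->|a0] := eqVneq a 0.
  by rewrite normr0 mul0r (le_trans _ (le_thick_norm _ None)).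
(* The reverse inequality is [thick_normZ_le] for the scalar [a^-1] and the vector [a *: x]. *)
rewrite -ler_pdivlMl ?normr_gt0// -normfV.
by rewrite -[X in thick_norm X <= _](scalerK a0) thick_normZ_le.
Qed.

Lemma thick_norm0_eq0 (x : thick) : thick_norm x = 0 -> x = 0.
Proof.
move=> x0; apply: thick_eq => o; apply/eqP; rewrite -normr_le0 -x0.
exact: le_thick_norm.
Qed.

HB.instance Definition _ := Lmodule_isNormed.Build R thick
  thick_normD thick_normZ thick_norm0_eq0.

Lemma thick_normE (x : thick) : `|x| = thick_norm x. Proof. by []. Qed.

Lemma norm_thick_leP (x : thick) M : `|x| <= M <-> `|x None| <= M /\
  forall s, `|x (Some s)| + slant * `|x None| <= M.
Proof.
rewrite thick_normE thick_norm_leP; split=> [xM|[xN xM] s].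
  split=> [|s]; first by have := xM cantor0; rewrite thick_val_le => /andP[].
  by have := xM s; rewrite thick_val_le => /andP[].
by rewrite thick_val_le xN xM.
Qed.

(** The norm is at most [1 + slant] times the supremum norm over [option cantor], so uniform
    convergence suffices. *)
Lemma cvg_thick (F : set_system thick) (x : thick) : Filter F ->
  (forall e, 0 < e ->
    \forall y \near F, forall o, `|x o - (y : thick) o| <= e) ->
  F --> x.
Proof.
move=> FF Fx; apply/cvgrPdist_le => /= e e0.
have s1 : 0 < 1 + slant by rewrite ltr_wpDr ?slant_ge0.
have e1 : 0 < e / (1 + slant) by rewrite divr_gt0.
apply: filterS (Fx _ e1) => y xy; apply/norm_thick_leP; rewrite !thickB.
have le_e : e / (1 + slant) + slant * (e / (1 + slant)) <= e.
  by rewrite -{1}[e / _]mul1r -mulrDl mulrC divfK// gt_eqF.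
split=> [|s].
  apply: le_trans le_e; apply: le_trans (xy _) _.
  by rewrite lerDl mulr_ge0 ?slant_ge0// ltW.
by apply: le_trans le_e; rewrite thickB lerD// ler_wpM2l ?slant_ge0.
Qed.

(** The pointwise limit [g] is a uniform limit, hence bounded and continuous; the anchor condition
    passes to pointwise limits. *)
Lemma thick_complete (F : set_system thick) : ProperFilter F ->
  cauchy F -> cvg F.
Proof.
move=> FF /cauchy_ballP Fc.
pose ev o (x : thick) : R^o := x o.
have evB o (x y : thick) e : ball x e y -> `|ev o x - ev o y| < e.
  by rewrite -ball_normE/= -[_ - ev o y]thickB; exact/le_lt_trans/le_thick_norm.
have cvF o : cvg (ev o @ F).
  apply: cauchy_cvg; apply/cauchy_ballP => e e0; rewrite near_map2.
  by apply: filterS (Fc _ e0) => -[x y] /=; exact: evB.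
pose g o : R^o := lim (ev o @ F).
have gF e : 0 < e -> \forall x \near F, forall o, `|g o - ev o x| <= e.
  move=> e0; have e2 : 0 < e / 2 by rewrite divr_gt0.
  (* The auxiliary [y] may depend on [o], whereas the Cauchy condition imposed on [x] does not; this
     makes the estimate uniform. *)
  near=> x => o; near F => y.
  have gy : `|g o - ev o y| <= e / 2.
    by near: y; apply: (@cvgr_dist_le _ R^o _ F _ (ev o) (g o)); [exact: cvF|].
  have xy : ball x (e / 2) y.
    by near: y; near: x; apply: nearP_dep; exact: Fc.
  have := evB o _ _ _ xy; rewrite distrC.
  by move: gy; rewrite !ler_norml !ltr_norml; lra.
have gP : in_thick g.
  split=> [|u e e0|].
  - near F => x; have gx : forall o, `|g o - ev o x| <= 1.
      by near: x; exact: gF.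
    have [[M xM] _ _] := thick_in x; exists (1 + M) => o.
    rewrite -[g o](subrK (ev o x)); apply: le_trans (ler_normD _ _) _.
    by apply: lerD; [exact: gx|exact: xM].
  - have e3 : 0 < e / 3 by rewrite divr_gt0.
    near F => x; have gx : forall o, `|g o - ev o x| <= e / 3.
      by near: x; exact: gF.
    have [_ /(_ u _ e3)[k xk] _] := thick_in x.
    exists k => v /xk uv; move: (gx (Some u)) (gx (Some v)) uv.
    by rewrite /ev !ler_norml; lra.
  - have : anchor * ev None x @[x --> F] --> anchor * g None.
      by apply: cvgMr; exact: cvF.
    have -> : (fun x => anchor * ev None x) = ev (Some cantor0).
      by apply/funext => x; have [_ _] := thick_in x.
    by move=> /cvg_lim; apply.
have gT : g \in thick_pred by rewrite inE.
apply/cvg_ex; exists (Thick _ gT); apply: cvg_thick => e e0; exact: gF.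
Unshelve. all: by end_near. Qed.

HB.instance Definition _ := Uniform_isComplete.Build thick thick_complete.

End thick_space.

(** * Upper bound for the slice index *)

Section thickness_upper_bound.
Context {R : realType} (r : R).
Hypothesis r02 : 0 <= r <= 2.

(** One of the two constants vanishes, and their sum is [|r - 1|]. *)
Lemma anchorD_le1 : anchor r + slant r <= 1.
Proof.
case/andP: r02 => r0 r2; rewrite /anchor /slant.
by case: (leP (r - 1) 0) => ?; case: (leP (1 - r) 0) => ?; lra.
Qed.

Definition top_coord (x : thick r) : R^o := x None.

Lemma top_coord_linear : linear top_coord.
Proof. by []. Qed.

HB.instance Definition _ :=
  GRing.isLinear.Build R (thick r) R^o *:%R top_coord top_coord_linear.

Lemma top_coord_continuous : continuous top_coord.
Proof.
apply/linear_bounded_continuous/linear_boundedP.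
near=> C => x; have xN : `|top_coord x| <= `|x| := le_thick_norm r x None.
apply: le_trans xN _.
rewrite -[leLHS]mul1r ler_wpM2r ?normr_ge0//.
Unshelve. all: by end_near. Qed.

Definition top_dual : dual (thick r) := Dual top_coord_continuous.

Lemma in_thick_peak :
  in_thick r (fun o : option cantor => if o is Some _ then anchor r else 1).
Proof.
split=> [|u e e0|]; last by rewrite mulr1.
- exists 1 => -[s|]; last by rewrite normr1.
  rewrite ger0_norm ?anchor_ge0//.
  by have := anchorD_le1; have := slant_ge0 r; lra.
- by exists 0%N => v _; rewrite subrr normr0 ltW.
Qed.

Definition peak : thick r := Thick r _ (mem_set in_thick_peak).

Lemma norm_peak : `|peak| = 1.
Proof.
apply/eqP; rewrite eq_le; apply/andP; split; last first.
  by have := le_thick_norm r peak None; rewrite /= normr1.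
apply/norm_thick_leP; rewrite /= normr1; split=> // _.
by rewrite mulr1 ger0_norm ?anchor_ge0// anchorD_le1.
Qed.

Lemma dual_norm_top : dual_norm top_dual = 1.
Proof.
apply/eqP; rewrite eq_le; apply/andP; split.
  apply: ge_sup.
    by exists `|top_dual 0|, 0 => //; apply/unit_ballP; rewrite normr0.
  move=> _ [x /unit_ballP x1 <-].
  exact: le_trans (le_thick_norm r x None) x1.
apply: ub_le_sup.
  exists 1 => _ [x /unit_ballP x1 <-].
  exact: le_trans (le_thick_norm r x None) x1.
exists peak; first by apply/unit_ballP; rewrite norm_peak.
by rewrite /= /top_coord/= normr1.
Qed.

Lemma thickness_s_le : (thickness_s (thick r) <= r%:E)%E.
Proof.
move: r02 => /andP[r0 _].
have h0 := slant_ge0 r; have h1 := anchorD_le1; have m0 := anchor_ge0 r.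
have mh := anchorB r.
apply/lee_addgt0Pr => e e0; apply: ereal_inf_lbound.
exists (r + e); last by rewrite EFinD.
split; first lra.
exists peak, (slice top_dual (e / 2)); split; first exact: norm_peak.
  by exists top_dual, (e / 2); split => //; [exact: dual_norm_top|lra].
move=> x [/unit_ballP/norm_thick_leP[xN xs] /=]; rewrite /top_coord => xe.
rewrite closed_ballE; last lra.
have {xN} xN1 : x None <= 1 by rewrite (le_trans (ler_norm _)).
have d : `|1 - x None| <= e / 2 by rewrite ger0_norm; lra.
rewrite /closed_ball_/=; apply/norm_thick_leP.
rewrite !thickB; split=> [|s]; first by rewrite /=; lra.
(* With m, h as in the header, the estimates below add up to m + 1 - h(1 - e/2) + h e/2 = r + h e,
   and h <= 1. *)
rewrite thickB /=; have := xs s.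
have : slant r * (1 - e / 2) <= slant r * `|x None|.
  by rewrite ler_wpM2l//; have := ler_norm (x None); lra.
have : slant r * `|1 - x None| <= slant r * (e / 2) by rewrite ler_wpM2l.
have : slant r * e <= e by rewrite ler_piMl//; lra.
have : `|anchor r - x (Some s)| <= anchor r + `|x (Some s)|.
  by rewrite (le_trans (ler_normB _ _))// ger0_norm.
lra.
Qed.

End thickness_upper_bound.

(** * Disjoint cylinders accumulating at a point of the Cantor space *)

Section cantor_bumps.

Definition splits_at (u : cantor) (n : nat) (v : cantor) : Prop :=
  agree n u v /\ u n != v n.

Lemma splits_at_inj u n n' v :
  splits_at u n v -> splits_at u n' v -> n = n'.
Proof.
move=> [a d] [a' d']; case: (ltngtP n n') => // nn'.
  by move: d; rewrite a'// eqxx.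
by move: d'; rewrite a// eqxx.
Qed.

(** Splitting at [n] involves the coordinates up to [n] included, hence [n.+1]. So these sets are
    clopen, which makes the bumps below continuous. *)
Lemma splits_at_agree u n v v' : agree n.+1 v v' ->
  splits_at u n v <-> splits_at u n v'.
Proof.
move=> vv'; rewrite /splits_at vv'//.
by split=> -[a d]; split=> // i ni; rewrite a// vv'// ltnS ltnW.
Qed.

(** Used with [v = cantor0], to keep the bumps away from the point where the anchor condition
    lives. *)
Lemma splits_at_eventually u v : exists k, forall n, (k <= n)%N ->
  ~ splits_at u n v.
Proof.
have [uv|/existsNP[i /eqP ui]] := pselect (forall i, u i = v i).
  by exists 0%N => n _ [_]; rewrite uv eqxx.
by exists i.+1 => n ni [a _]; move: ui; rewrite a ?eqxx.
Qed.

Definition flip (u : cantor) (n : nat) : cantor :=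
  fun i => if i == n then ~~ u i else u i.

Lemma splits_at_flip u n : splits_at u n (flip u n).
Proof.
split=> [i ni|]; rewrite /flip; first by rewrite ltn_eqF.
by rewrite eqxx; case: (u n).
Qed.

End cantor_bumps.

(** * Lower bound for the index of convex combinations *)

Section thickness_lower_bound.
Context {R : realType} (r : R).
Hypothesis r02 : 0 <= r <= 2.

(** Adding [y] to [x] resets [x] to the constant [c] on one cylinder and changes nothing else. *)
Definition is_bump (x : thick r) (u : cantor) (c : R) (n : nat) (y : thick r) :=
  y None = 0 /\ forall v, y (Some v) =
    if `[< splits_at u n v >] then c - x (Some v) else 0.

Lemma bump_exists x u c n :
  ~ splits_at u n cantor0 -> exists y, is_bump x u c n y.
Proof.
move=> n0; have [[M xM] cx _] := thick_in r x.
pose f (o : option cantor) : R^o := if o is Some v then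
  if `[< splits_at u n v >] then c - x (Some v) else 0 else 0.
suff fP : in_thick r f by exists (Thick r _ (mem_set fP)).
split=> [|v e e0|].
- exists (`|c| + M) => -[v|] /=.
    case: asboolP => _; first by rewrite (le_trans (ler_normB _ _))// lerD.
    by rewrite normr0 addr_ge0// (le_trans _ (xM None)).
  by rewrite normr0 addr_ge0// (le_trans _ (xM None)).
- have [k xk] := cx v e e0; exists (maxn k n.+1) => w vw.
  have kvw : agree k v w by move=> i ik; apply: vw; rewrite leq_max ik.
  have nvw : agree n.+1 v w by move=> i ik; apply: vw; rewrite leq_max ik orbT.
  rewrite /f (asbool_equiv_eq (splits_at_agree u n v w nvw)).
  case: asboolP => _; last by rewrite subrr normr0 ltW.
  by rewrite distrC opprB addrC addrA subrK xk.
- by rewrite /f mulr0; case: asboolP.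
Qed.

Lemma bump_weakly_null x u c k (h : nat -> thick r) :
  `|x| <= 1 -> `|c| <= 1 -> (forall n, is_bump x u c (k + n) (h n)) ->
  forall f : dual (thick r), f (h n) @[n --> \oo] --> (0 : R).
Proof.
move=> x1 c1 hb f; apply: (@weakly_null _ _ _ 2) => N s s1.
apply/norm_thick_leP; rewrite thick_sum big1 ?normr0 => [|n _]; last first.
  by rewrite thickZ; have [-> _] := hb n; rewrite mulr0.
split=> // v; rewrite mulr0 addr0 thick_sum.
have [[n nv]|nv] := pselect (exists n : 'I_N, splits_at u (k + n) v).
  rewrite (bigD1 n)// big1 => [|m /andP[_ mn]].
    rewrite thickZ; have [_ ->] := hb n; rewrite asboolT//= addr0 normrM.
    have : `|c - x (Some v)| <= 2.
      rewrite (le_trans (ler_normB _ _))//.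
      by have := le_trans (le_thick_norm r x (Some v)) x1; lra.
    by apply: le_trans; rewrite ler_piMl.
  rewrite thickZ; have [_ ->] := hb m; rewrite asboolF ?mulr0// => mv.
  move/eqP: mn; apply; apply/val_inj/(@addnI k).
  exact: splits_at_inj mv nv.
rewrite big1 ?normr0// => n _; rewrite thickZ; have [_ ->] := hb n.
by rewrite asboolF ?mulr0// => ?; apply: nv; exists n.
Qed.

(** The value at [None] is unchanged and at most 1 in modulus, so on the cylinder the norm condition
    follows from the bound on [c]. *)
Lemma bump_norm_le x u c n y : `|x| <= 1 -> `|c| + slant r <= 1 ->
  is_bump x u c n y -> `|x + y| <= 1.
Proof.
move=> /norm_thick_leP[xN xs] c1 [y0 ys]; apply/norm_thick_leP.
rewrite thickD y0 addr0; split=> // s; rewrite thickD ys.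
case: asboolP => _; last by rewrite addr0.
rewrite [x _ + _]addrC subrK (le_trans _ c1)// lerD// ler_piMr//.
exact: slant_ge0.
Qed.

Lemma norm_attained (x : thick r) (e : R) : `|x| = 1 -> 0 < e ->
  exists u, anchor r - e < `|x (Some u)|.
Proof.
move=> x1 e0; have m0 := anchor_ge0 r; have h1 := anchorD_le1 r r02.
have h0 := slant_ge0 r.
have [m00|m_neq0] := eqVneq (anchor r) 0.
  by exists cantor0; rewrite m00; have := normr_ge0 (x (Some cantor0)); lra.
have hE : slant r = 0.
  have : anchor r > 0 by rewrite lt_neqAle eq_sym m_neq0.
  by have := anchorB r; rewrite /anchor /slant;
     case: (leP (r - 1) 0) => ?; case: (leP (1 - r) 0) => ?; lra.
have : 1 - e < sup (range (thick_val r x)).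
  by rewrite -/(thick_norm r x) -thick_normE x1; lra.
move=> /sup_gt[|_ [s _ <-]].
  by exists (thick_val r x cantor0), cantor0.
rewrite /thick_val hE mul0r addr0 lt_max => /orP[xN|xs]; last by exists s; lra.
(* If only [x None] is nearly 1 in modulus, the anchor transfers this to [cantor0]: m|t| > m(1 - e)
   >= m - e, as 0 < m <= 1. *)
exists cantor0; have [_ _ ->] := thick_in r x; rewrite normrM ger0_norm//.
have : anchor r * (1 - e) <= anchor r * `|x None| by rewrite ler_wpM2l// ltW.
have : anchor r * e <= e by rewrite ler_piMl; lra.
have : 0 < anchor r by rewrite lt_neqAle eq_sym m_neq0.
nra.
Qed.

Lemma norm_locally_attained (x : thick r) (e : R) : `|x| = 1 -> 0 < e ->
  exists u s k, [/\ `|s| = 1 &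
    forall v, agree k u v -> anchor r - e <= s * x (Some v)].
Proof.
move=> x1 e0; have e2 : 0 < e / 2 by rewrite divr_gt0.
have [u xu] := norm_attained _ _ x1 e2.
have [_ /(_ u _ e2)[k xk] _] := thick_in r x.
(* A sign that is never 0, so that it has modulus 1 even if [x (Some u)] vanishes. One [e / 2] is
   spent at [u], the other on continuity. *)
exists u, (if 0 <= x (Some u) then 1 else -1), k; split.
  by case: ifP; rewrite ?normrN1 ?normr1.
move=> v /xk; case: (lerP 0 (x (Some u))) xu => xu0 + /ler_normlP[? ?].
  by rewrite ger0_norm//; lra.
by rewrite ltr0_norm//; lra.
Qed.

Lemma convex_comb_far (C : set (thick r)) (x : thick r) (e : R) :
  C !=set0 -> is_convex_comb_rel_weakly_open C -> `|x| = 1 -> 0 < e ->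
  exists2 y, C y & r - e <= `|x - y|.
Proof.
move=> C0 [n [l [W [l01 l1 oW CE]]]] x1 e0.
move: C0; rewrite CE => -[z [w Ww _]].
have [u [s [k [s1 xk]]]] := norm_locally_attained _ _ x1 e0.
have [k' k'0] := splits_at_eventually u cantor0.
(* Opposite in sign to [x] near [u], with the largest modulus that [bump_norm_le] allows. *)
pose c := - s * (1 - slant r).
have h0 := slant_ge0 r; have h1 := anchorD_le1 r r02; have m0 := anchor_ge0 r.
have cE : `|c| = 1 - slant r.
  by rewrite normrM normrN s1 mul1r ger0_norm//; lra.
(* From [K] on, the cylinders lie where [s * x] is at least m - e, and they miss [cantor0]. *)
pose K := (k + k')%N.
have /choice[h hP] : forall i, exists h : nat -> thick r,
    forall j, is_bump (w i) u c (K + j) (h j).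
  move=> i; suff /choice[h] : forall j, exists y, is_bump (w i) u c (K + j) y.
    by exists h.
  by move=> j; apply: bump_exists; apply: k'0; rewrite /K; lia.
have w1 i : `|w i| <= 1.
  by have [U _ WE] := oW i; move: (Ww i); rewrite WE => -[_ /unit_ballP].
(* There are finitely many members, so a single index [j] serves them all. *)
have : \forall j \near \oo, forall i, W i (w i + h i j).
  apply: filter_forall => i; apply: rel_weakly_open_near => //.
    by apply: (@bump_weakly_null (w i) u c K); rewrite ?w1 ?cE//; lra.
  by move=> j; apply: bump_norm_le (w1 i) _ (hP i j); rewrite cE subrK.
move=> /filter_ex[j Wj].
exists (\sum_(i < n) l i *: (w i + h i j)).
  by exists (fun i => w i + h i j).
set y := \sum_(i < n) _; pose v := flip u (K + j).
have uv : splits_at u (K + j) v := splits_at_flip u (K + j).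
(* All modified members take the value [c] at [v], and the weights sum to 1. *)
have yv : y (Some v) = c.
  rewrite /y thick_sum -[RHS]mul1r -l1 mulr_suml; apply: eq_bigr => i _.
  rewrite thickZ thickD; have [_ ->] := hP i j.
  by rewrite asboolT// addrC subrK.
apply: le_trans (le_thick_norm r (x - y) (Some v)); rewrite thickB yv.
rewrite -[leRHS]mul1r -s1 -normrM (le_trans _ (ler_norm _))//.
have ss : s * s = 1 by rewrite -expr2 -real_normK ?num_real// s1 expr1n.
rewrite mulrBr /c mulNr mulrN opprK mulrA ss mul1r.
have : agree k u v by move=> i ik; case: uv => + _; apply; rewrite /K; lia.
by move=> /xk; have := anchorB r; lra.
Qed.

Lemma le_thickness_cc : (r%:E <= thickness_cc (thick r))%E.
Proof.
apply: le_ereal_inf_tmp => _ [s [s0 [x [C [x1 [C0 cC] Cs]]]] <-].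
rewrite lee_fin; apply/ler_addgt0Pr => e e0.
have [y /Cs + ye] := convex_comb_far _ _ _ C0 cC x1 e0.
by rewrite closed_ballE// /closed_ball_/=; lra.
Qed.

End thickness_lower_bound.

Theorem theorem2p7 (R : realType) (r : R) (hr : 0 <= r <= 2) :
  exists X : completeNormedModType R,
    (exists x : X, x != 0) /\
    [/\ thickness_s X = r%:E, thickness X = r%:E & thickness_cc X = r%:E].
Proof.
(* The indices are squeezed: r <= [thickness_cc] <= [thickness] <= [thickness_s] <= r. *)
have sr := thickness_s_le r hr; have rcc := le_thickness_cc r hr.
have cct := @thickness_cc_le_thickness _ (thick r).
have ts := @thickness_le_thickness_s _ (thick r).
exists (thick r : completeNormedModType R); split.
  by exists (peak r hr); rewrite -normr_gt0 norm_peak.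
split; apply/eqP; rewrite eq_le; apply/andP; split => //.
- exact: le_trans rcc (le_trans cct ts).
- exact: le_trans ts sr.
- exact: le_trans rcc cct.
- exact: le_trans cct (le_trans ts sr).
Qed.
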